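(* Let $X$ be a nonempty set, let $\leq$ be a total ordering on $X$ and let $\precsim$ be a weak ordering on $X$. Then $\precsim$ is weakly single-peaked for $\leq$ if and only if the following two conditions hold. (a) For any $a,b,c\in X$ such that $b\in\mathrm{conv}_{\leq}(a,c)$, we have $b\precsim a$ or $b\precsim c$. (b') If $P\subseteq X$, $|P|\geq 2$, is a plateau for $(\leq,\precsim)$, then it is $\precsim$-minimal in the sense that for every $a\in X$ satisfying $a\precsim P$ there exists $z\in P$ such that $z\sim a$.
   Context: A weak ordering $\precsim$ on $X$ is a total and transitive binary relation, with symmetric part $\sim$ ($x\sim y$ iff $x\precsim y$ and $y\precsim x$) and asymmetric part $\prec$ ($x\prec y$ iff $x\precsim y$ and not $y\precsim x$); $[x]_{\sim}$ is the equivalence class of $x$. A total ordering is a total, transitive, antisymmetric relation. $\precsim$ is weakly single-peaked for $\leq$ if for any $a,b,c\in X$ such that $a<b<c$, we have $b\prec a$ or $b\prec c$ or $a\sim b\sim c$. The strict convex hull is $\mathrm{conv}_{\leq}(x,y)=\{z\in X: x<z<y\}$ if $x<y$, and $\mathrm{conv}_{\leq}(x,y)=\{z\in X: y<z<x\}$ if $y<x$. A subset $C\subseteq X$ is convex for $\leq$ if for any $a,b,c\in X$ with $b\in\mathrm{conv}_{\leq}(a,c)$, $a,c\in C$ implies $b\in C$. A subset $P$ of $X$ with $|P|\geq 2$ is a plateau for $(\leq,\precsim)$ if $P$ is convex for $\leq$ and there exists $x\in X$ such that $P\subseteq[x]_{\sim}$. The notation $a\precsim P$ means $a\precsim z$ for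 all $z\in P$. *)

(* Defs.v *)
From Stdlib Require Export Relation_Definitions Ensembles.

Set Implicit Arguments.
Unset Strict Implicit.
Unset Printing Implicit Defensive.

Definition total (X : Type) (R : relation X) : Prop :=
  forall x y : X, R x y \/ R y x.

Definition weak_ordering (X : Type) (R : relation X) : Prop :=
  total R /\ transitive X R.

Definition total_ordering (X : Type) (R : relation X) : Prop :=
  total R /\ transitive X R /\ antisymmetric X R.

Definition sym_part (X : Type) (R : relation X) : relation X :=
  fun x y => R x y /\ R y x.

Definition asym_part (X : Type) (R : relation X) : relation X :=
  fun x y => R x y /\ ~ R y x.

Definition eq_class (X : Type) (R : relation X) (x : X) : Ensemble X :=
  fun y => sym_part R y x.

Definition weakly_single_peaked (X : Type) (le pref : relation X) : Prop :=
  forall a b c : X,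
    asym_part le a b -> asym_part le b c ->
    asym_part pref b a \/ asym_part pref b c \/
    (sym_part pref a b /\ sym_part pref b c).

(* The strict convex hull is only specified for x < y and y < x; it is taken
   to be empty when x = y. *)
Definition conv (X : Type) (le : relation X) (x y : X) : Ensemble X :=
  fun z =>
    (asym_part le x y /\ asym_part le x z /\ asym_part le z y) \/
    (asym_part le y x /\ asym_part le y z /\ asym_part le z x).

Definition convex (X : Type) (le : relation X) (C : Ensemble X) : Prop :=
  forall a b c : X,
    In X (conv le a c) b -> In X C a -> In X C c -> In X C b.

(* |P| >= 2, for a possibly infinite P. *)
Definition at_least_two (X : Type) (P : Ensemble X) : Prop :=
  exists x y : X, In X P x /\ In X P y /\ x <> y.

Definition plateau (X : Type) (le pref : relation X) (P : Ensemble X) : Prop :=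
  at_least_two P /\ convex le P /\
  exists x : X, Included X P (eq_class pref x).

Definition below_set (X : Type) (pref : relation X) (a : X) (P : Ensemble X)
  : Prop :=
  forall z : X, In X P z -> pref a z.

Definition minimal_set (X : Type) (pref : relation X) (P : Ensemble X) : Prop :=
  forall a : X, below_set pref a P ->
    exists z : X, In X P z /\ sym_part pref z a.

(* Main.v *)
(* For necessity, an element strictly below a plateau [P] cannot lie between two
   points [x < y] of [P] by convexity, and outside of them it contradicts weak
   single-peakedness at [x] or [y].  For sufficiency, the only case that (a) does
   not settle is [b] strictly between [a] and [c] with [a ~ b] and [c] strictly
   preferred to [b]; then (a) makes the closed segment from [a] to [b] a plateau
   which [c] prevents from being minimal. *)
Require Import Defs.
From Stdlib Require Import Classical.

Set Implicit Arguments.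
Unset Strict Implicit.
Unset Printing Implicit Defensive.

(** The closed hull of [u] and [v]. Both orientations are included, so that the endpoints can be
    used without knowing which is smaller. *)
Definition segment (X : Type) (le : relation X) (u v : X) : Ensemble X :=
  fun z => (le u z /\ le z v) \/ (le v z /\ le z u).

Lemma asym_part_or (X : Type) (R : relation X) (x y : X) :
  total R -> R x y \/ asym_part R y x.
Proof.
  intros tot; destruct (classic (R x y)) as [xy | nxy]; [now left | right].
  split; [now destruct (tot x y) | exact nxy].
Qed.

Lemma conv_sym (X : Type) (le : relation X) (x y z : X) :
  In X (conv le x y) z -> In X (conv le y x) z.
Proof. unfold In, conv; tauto. Qed.

Lemma conv_between (X : Type) (le : relation X) (a b c : X) :
  transitive X le -> asym_part le a b -> asym_part le b c ->
  In X (conv le a c) b.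
Proof.
  intros tr [ab nba] [bc ncb]; left; repeat split; auto.
  - exact (tr _ _ _ ab bc).
  - intros ca; exact (ncb (tr _ _ _ ca ab)).
Qed.

Lemma convex_segment (X : Type) (le : relation X) (u v : X) :
  transitive X le -> convex le (segment le u v).
Proof.
  intros tr a b c hb ha hc.
  assert (tr' : forall x y z, le x y -> le y z -> le x z) by exact tr.
  unfold In, segment, conv, asym_part in *.
  destruct hb as [(_ & [ab _] & [bc _]) | (_ & [cb _] & [ba _])];
    destruct ha as [[] | []]; destruct hc as [[] | []];
    solve [left; split; eauto | right; split; eauto].
Qed.

Lemma segment_open (X : Type) (le : relation X) (u v z : X) :
  transitive X le -> antisymmetric X le -> In X (segment le u v) z ->
  z = u \/ z = v \/ In X (conv le u v) z.
Proof.
  intros tr anti hz.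
  destruct (classic (z = u)) as [| zu]; [now left | right].
  destruct (classic (z = v)) as [| zv]; [now left | right].
  destruct hz as [[h1 h2] | [h1 h2]]; [| apply conv_sym];
    apply conv_between; auto; split; auto.
Qed.

Lemma weakly_single_peaked_minimal_plateau (X : Type) (le pref : relation X)
  (P : Ensemble X) :
  total_ordering le -> weakly_single_peaked le pref ->
  plateau le pref P -> transitive X pref -> minimal_set pref P.
Proof.
  intros (tot & tr & anti) wsp ((x & y & Px & Py & xy) & cvx & w & Pw) prtr a ha.
  apply NNPP; intros no.
  (* Since [a] is below all of [P], a failure of minimality puts every point of [P] strictly above
     [a]; by reflexivity on [P], this also excludes [a] from [P]. *)
  assert (strict : forall z, In X P z -> ~ pref z a).
  { intros z Pz za; apply no; exists z; repeat split; auto. }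
  assert (flat : forall s t, In X P s -> In X P t -> pref s t).
  { intros s t Ps Pt; destruct (Pw _ Ps), (Pw _ Pt); eapply prtr; eauto. }
  assert (ordered : forall s t, In X P s -> In X P t -> asym_part le s t -> False).
  { intros s t Ps Pt st.
    destruct (asym_part_or s a tot) as [sa | as_].
    - destruct (asym_part_or a t tot) as [at_ | ta].
      + destruct (classic (a = s)) as [-> | nas]; [exact (strict _ Ps (flat _ _ Ps Ps)) |].
        destruct (classic (a = t)) as [-> | nat_]; [exact (strict _ Pt (flat _ _ Pt Pt)) |].
        assert (Pa : In X P a).
        { apply (cvx s a t); auto; apply conv_between; auto; split; auto. }
        exact (strict _ Pa (flat _ _ Pa Pa)).
      (* Here [s < t < a]: [t] is not strictly preferred to [s] because [P] is flat, and both other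
         alternatives give [pref t a]. The case [a < s < t] below is the mirror image. *)
      + destruct (wsp _ _ _ st ta) as [[_ h] | [[h _] | [_ [h _]]]];
          [exact (h (flat _ _ Ps Pt)) | exact (strict _ Pt h) ..].
    - destruct (wsp _ _ _ as_ st) as [[h _] | [[_ h] | [[_ h] _]]];
        [exact (strict _ Ps h) | exact (h (flat _ _ Pt Ps)) | exact (strict _ Ps h)]. }
  destruct (tot x y) as [h | h]; [apply (ordered x y) | apply (ordered y x)];
    auto; split; auto.
Qed.

(** Phrased with [conv], so that it applies to either neighbour of [b], whichever one is indifferent
    to it. *)
Lemma indifferent_neighbour_dominates (X : Type) (le pref : relation X)
  (a b c : X) :
  total_ordering le -> weak_ordering pref ->
  (forall a b c : X, In X (conv le a c) b -> pref b a \/ pref b c) ->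
  (forall P : Ensemble X, plateau le pref P -> minimal_set pref P) ->
  In X (conv le a c) b -> sym_part pref a b -> pref b c.
Proof.
  intros (tot & tr & anti) (ptot & ptr) quasi mini hb [ab ba].
  destruct (asym_part_or b c ptot) as [| [cb nbc]]; auto.
  exfalso.
  assert (bb : pref b b) by (destruct (ptot b b); auto).
  assert (flat : forall z, In X (segment le a b) z -> sym_part pref z b).
  { intros z hz.
    destruct (segment_open tr anti hz) as [-> | [-> | zin]];
      [split; auto .. |].
    (* A point [z] strictly between [a] and [b] lies on the side of [b] away from [c]; the two cases
       with opposite orientations are contradictory. *)
    assert (bin : In X (conv le z c) b).
    { destruct zin as [(_ & az & zb) | (_ & bz & za)].
      - destruct hb as [(_ & _ & bc) | (_ & _ & [ba' _])].
        + now apply conv_between.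
        + destruct zb as [zb nbz], az as [az _].
          contradict nbz; exact (tr _ _ _ ba' az).
      - destruct hb as [(_ & [ab' _] & _) | (_ & cb' & _)].
        + destruct bz as [bz nzb], za as [za _].
          contradict nzb; exact (tr _ _ _ za ab').
        + now apply conv_sym, conv_between. }
    split.
    (* Condition (a) at [a, z, b] bounds [z] by [a] or [b], which are indifferent. At [z, b, c] it
       gives [pref b z], since [pref b c] is excluded. *)
    - destruct (quasi _ _ _ zin) as [za |]; [exact (ptr _ _ _ za ab) | assumption].
    - destruct (quasi _ _ _ bin); [assumption | contradiction]. }
  assert (pl : plateau le pref (segment le a b)).
  { split; [| split; [now apply convex_segment | now exists b]].
    exists a, b.
    assert (refl : forall x, le x x) by (intros x; destruct (tot x x); auto).
    repeat split.
    - destruct (tot a b); [left | right]; auto.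
    - destruct (tot a b); [left | right]; auto.
    - intros ->.
      destruct hb as [(_ & [h nh] & _) | (_ & _ & [h nh])]; auto. }
  (* Minimality would yield a point [z] of the segment indifferent to [c], and [pref b z] then
     forces [pref b c]. *)
  destruct (mini _ pl c) as (z & hz & zc & _).
  - intros z hz; exact (ptr _ _ _ cb (proj2 (flat z hz))).
  - exact (nbc (ptr _ _ _ (proj2 (flat z hz)) zc)).
Qed.

Theorem theorem5p6 (X : Type) (X_nonempty : inhabited X)
  (le pref : relation X)
  (le_total_ordering : total_ordering le)
  (pref_weak_ordering : weak_ordering pref) :
  weakly_single_peaked le pref <->
  ((forall a b c : X, In X (conv le a c) b -> pref b a \/ pref b c) /\
   (forall P : Ensemble X,
      at_least_two P -> plateau le pref P -> minimal_set pref P)).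
Proof.
  pose proof pref_weak_ordering as [ptot ptr]; split.
  - intros wsp; split.
    + intros a b c [(_ & h1 & h2) | (_ & h1 & h2)];
        destruct (wsp _ _ _ h1 h2) as [[] | [[] | [[] []]]]; auto.
    + intros P _ pl; now apply weakly_single_peaked_minimal_plateau with le.
  - intros [quasi mini] a b c ab bc.
    assert (mini' : forall P, plateau le pref P -> minimal_set pref P)
      by (intros P pl; apply mini; [exact (proj1 pl) | exact pl]).
    assert (tr : transitive X le) by apply le_total_ordering.
    pose proof (conv_between tr ab bc) as hb.
    (* Once strict preference for [b] over [a] or [c] is set aside, [pref a b] and [pref c b]
       remain. Condition (a) then makes [b] indifferent to one neighbour, and the lemma above
       carries this to the other. *)
    destruct (asym_part_or a b ptot) as [pab | pba]; [| now left].
    destruct (asym_part_or c b ptot) as [pcb | pbc]; [| now right; left].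
    right; right; destruct (quasi _ _ _ hb) as [pba | pbc]; repeat split; auto.
    + apply indifferent_neighbour_dominates with le a; auto; split; auto.
    + apply indifferent_neighbour_dominates with le c; auto; [| split; auto].
      now apply conv_sym.
Qed.
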